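(* Let $S=PSL(2,7)$ and let $G=Q_8\times(C_7\rtimes C_3)$, where $Q_8$ is the quaternion group of order $8$ and $C_7\rtimes C_3$ is the nonabelian group of order $21$. Then $S$ is a nonabelian simple $\alpha_5$-group, $G$ is an $\alpha_5$-group, and $|S|=|G|=168$, but $S\not\cong G$. Consequently, it is not true that for every positive integer $n$, every nonabelian simple $\alpha_n$-group $S$ and every $\alpha_n$-group $G$ with $|S|=|G|$, one has $S\cong G$.
   Context: All groups are finite. For a group $G$, define the equivalence relation $\sim$ on $G$ by $g\sim h \iff |g|=|h|$, where $|g|$ denotes the order of the element $g$. The same-order type of $G$, denoted $\alpha(G)$, is the set of sizes of the equivalence classes of $\sim$ (as a set, repeated values are counted once). $G$ is called an $\alpha_n$-group if $|\alpha(G)|=n$. $C_m$ denotes the cyclic group of order $m$. *)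

(* Defs.v *)
From HB Require Import structures.
From mathcomp Require Import all_boot all_order all_algebra all_fingroup all_solvable.
From mathcomp Require Import finmap.

Set Implicit Arguments.
Unset Strict Implicit.
Unset Printing Implicit Defensive.

Import GroupScope GRing.Theory.

Section SameOrderType.

Variable gT : finGroupType.
Implicit Types (A : {set gT}) (n : nat).

Definition same_order : rel gT := fun g h => #[g] == #[h].

Definition same_order_classes A : {set {set gT}} :=
  equivalence_partition same_order A.

Definition same_order_type A : {fset nat} :=
  [fset #|C| | C : {set gT} in same_order_classes A]%fset.

Definition alpha_group n A : bool := #|` same_order_type A|%fset == n.

End SameOrderType.

Section SpecialLinear.

(* As for {'GL_n[F]}, the matrices have size n.-1.+1, so n = 0 is read as 1. *)
Variables (n : nat) (F : finFieldType).

Definition SL : {set {'GL_n[F]}} := [set u | (\det (GLval u) == 1)%R].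

Lemma SL_group_set : group_set SL.
Proof.
apply/group_setP; split=> [|u v]; rewrite !inE ?GL_1E ?det1 //.
by move=> /eqP u1 /eqP v1; rewrite GL_MxE det_mulmx u1 v1 mulr1.
Qed.

Canonical SL_group := Group SL_group_set.

Definition PSL : {group coset_of 'Z(SL)} := (SL / 'Z(SL))%G.

End SpecialLinear.

(* Extremal.gtype 7 3 2 is the semidirect product of 'Z_7 by 'Z_3 in which a  *)
(* generator of 'Z_3 acts as x |-> x ^+ 2, an automorphism of order 3. The    *)
(* library construction silently falls back to the trivial action when there  *)
(* is no suitable automorphism; F21_nonabelian shows that this is not so here.*)
Definition F21 : finGroupType := Extremal.gtype 7 3 2.

Lemma card_F21 : #|[set: F21]| = 21.
Proof. exact: Extremal.card. Qed.

Lemma F21_nonabelian : ~~ abelian [set: F21].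
Proof.
have sq8 (x : 'Z_7) : x ^+ 2 ^+ 2 ^+ 2 = x.
  by apply/val_inj; case: x; do 7?case=> //.
have inj_sq : injective (fun x : 'Z_7 => x ^+ 2).
  by move=> x y xy; rewrite -[x]sq8 -[y]sq8 xy.
have exs : exists s, [/\ s \in Aut <[Zp1 : 'Z_7]>, #[s] %| 3
    & s (Zp1 : 'Z_7) = (Zp1 : 'Z_7) ^+ 2].
  exists (perm inj_sq); split; last by rewrite permE.
    rewrite inE; apply/andP; split.
      by apply/subsetP=> x _; rewrite -Zp_cycle inE.
    by apply/morphicP=> x y _ _; rewrite !permE expgMn //; apply: Zp_mulgC.
  rewrite order_dvdn; apply/eqP/permP=> x.
  by rewrite !expgS expg0 mulg1 perm1 !permM !permE sq8.
have isoF : [set: F21] \isog Grp (x : y : x ^+ 7, y ^+ 3, x ^ y = x ^+ 2).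
  exact: Extremal.Grp.
have /existsP[[x y] /=] := isoGrp_hom isoF.
rewrite !xpair_eqE => /and4P[/eqP genF _ /eqP y3 /eqP xy].
apply/negP=> /centsP cFF.
have x1 : x = 1.
  by apply: (mulgI x); rewrite mulg1 -expg2 -xy conjgE cFF ?inE // mulgK.
have : #|[set: F21]| %| 3.
  by rewrite -genF x1 cycle1 joing1G -orderE order_dvdn y3.
by rewrite card_F21.
Qed.

(* The external direct product Q_8 x (C_7 : C_3). *)
Definition Q8xF21 : {group 'Q_8 * F21} := [set: 'Q_8 * F21]%G.

(* Main.v *)
Require Import Defs.
From mathcomp Require Import all_boot all_order all_algebra.
From mathcomp Require Import all_fingroup all_solvable.
From mathcomp Require Import finmap ring.

Set Implicit Arguments.
Unset Strict Implicit.
Unset Printing Implicit Defensive.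

Import GroupScope GRing.Theory.

(** Everything is read off from how many elements of each order the groups
have. In PSL(2,7) the orders 1, 2, 3, 4, 7 occur 1, 21, 56, 42, 48 times
([PSL27_order_profile]); in Q_8 x (C_7 : C_3) the class sizes that occur are
1, 6, 14, 36, 84 ([Q8xF21_order_profile]). Both sets of sizes have five
elements, and both groups have order 168, but they have 56 and 14 elements of
order 3 respectively, so they are not isomorphic.

For PSL(2,7): by Cayley-Hamilton, a 2 x 2 matrix A of determinant 1 and trace t
satisfies A^(n+1) = U_(n+1)(t) A - U_n(t), where U is the Lucas (Chebyshev)
sequence U_0 = 0, U_1 = 1, U_(n+2) = t U_(n+1) - U_n ([expmx22_lucas]). The
center of SL(2,F) consists of the scalar matrices, so when A is not scalar the
order of its image in PSL(2,F) is the least n > 0 with U_n(t) = 0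
([order_coset_SL2]). The element counts thus become counts of quadruples over
F_7, which are computed.

Simplicity follows from these counts alone ([PSL27_orders_simple]). If N is
normal in G, every element whose order is coprime to |G : N| lies in N, and the
number of such elements exceeds |N| for all divisors |N| of 168 except 1, 2, 4
and 168. If |N| is 2 or 4, an element of order 7 acting on N by conjugation
fixes a nontrivial y in N, because |N| is not 1 modulo 7; its product with y
then has order 7 |y|, and no element has such an order.

For the direct product, the factors have coprime orders, so the number of
elements of order a b is the product of the numbers of elements of order a
in Q_8 and of order b in C_7 : C_3 ([order_count_pair]). *)

(** * Counting elements by order *)

Section OrderProfile.

Variable gT : finGroupType.
Implicit Types (A : {set gT}) (G : {group gT}).
Implicit Types (s : seq nat) (t : seq (nat * nat)).

Definition order_count A n := #|[set x in A | #[x] == n]|.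

Lemma sum_order_count A s :
  uniq s -> \sum_(n <- s) order_count A n = #|[set x in A | #[x] \in s]|.
Proof.
move=> s_uniq; pose oc n x : nat := (x \in A) && (#[x] == n).
transitivity (\sum_(n <- s) \sum_x oc n x).
  apply: eq_bigr => n _; rewrite /order_count -sum1_card big_mkcond /=.
  by apply: eq_bigr => x _; rewrite inE.
rewrite exchange_big -sum1_card [RHS]big_mkcond; apply: eq_bigr => x _ /=.
rewrite inE /oc; case: (x \in A); last by rewrite big1.
rewrite -[RHS]/(nat_of_bool (_ \in s)) -count_uniq_mem //.
rewrite -sum1_count [RHS]big_mkcond.
by apply: eq_bigr => n _; rewrite /= eq_sym; case: eqP.
Qed.

Lemma sum_order_count_all A s :
  uniq s -> {in A, forall x, #[x] \in s} ->
  \sum_(n <- s) order_count A n = #|A|.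
Proof.
move=> s_uniq As; rewrite sum_order_count //; apply: eq_card => x; rewrite !inE.
by case: (boolP (x \in A)) => // /As.
Qed.

(** A table of pairs (order, number of elements of that order). As the numbers
add up to the cardinal of A, no other order occurs in A. *)
Definition order_profile A t :=
  [/\ uniq (unzip1 t), {in t, forall p, order_count A p.1 = p.2}
    & #|A| = sumn (unzip2 t)].

Lemma order_profile_mem A t x :
  order_profile A t -> x \in A -> #[x] \in unzip1 t.
Proof.
case=> t_uniq tP oA; have := sum_order_count A t_uniq.
rewrite big_map (eq_big_seq _ tP) -(big_map snd xpredT idfun).
rewrite -sumnE /= -oA => cA.
have /eqP AE: [set x in A | #[x] \in unzip1 t] == A.
  by rewrite eqEcard -cA leqnn andbT; apply/subsetP=> y; rewrite inE => /andP[].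
by rewrite -{1}AE inE => /andP[].
Qed.

(** A lower bound for a set B that contains all elements of A whose order
satisfies P; it is used with B a normal subgroup. *)
Lemma order_profile_leq A (B : {set gT}) t (P : pred nat) :
    order_profile A t -> (forall x, x \in A -> P #[x] -> x \in B) ->
  sumn [seq p.2 | p <- t & P p.1] <= #|B|.
Proof.
case=> t_uniq tP _ AB.
have -> : sumn [seq p.2 | p <- t & P p.1]
    = \sum_(n <- [seq n <- unzip1 t | P n]) order_count A n.
  rewrite sumnE big_map [RHS]big_filter [RHS]big_map big_filter.
  rewrite big_seq_cond [RHS]big_seq_cond.
  by apply: eq_bigr => p /andP[/tP].
rewrite sum_order_count ?filter_uniq // subset_leq_card //.
by apply/subsetP=> x; rewrite inE mem_filter => /and3P[Ax Px _]; apply: AB.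
Qed.

Lemma mem_same_order_typeP A k :
  reflect (exists2 x, x \in A & k = order_count A #[x])
          (k \in same_order_type A).
Proof.
have cE x : #|[set y in A | same_order x y]| = order_count A #[x].
  by apply: eq_card => y; rewrite !inE /same_order eq_sym.
apply: (iffP (imfsetP _ _ _ _)) => /= [[C /imsetP[x Ax ->] ->]|[x Ax ->]].
  by exists x.
by exists [set y in A | same_order x y]; rewrite ?cE //; apply: imset_f.
Qed.

(** Absence of null entries matters: an order that does not occur would
contribute the spurious size 0. *)
Lemma alpha_group_profile A t : order_profile A t -> 0 \notin unzip2 t ->
  alpha_group (size (undup (unzip2 t))) A.
Proof.
move=> At t0; rewrite /alpha_group; apply/eqP.
have -> : same_order_type A = [fset k in undup (unzip2 t)]%fset.
  apply/fsetP=> k; rewrite inE mem_undup.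
  apply/mem_same_order_typeP/mapP => [[x Ax ->]|[[n c] tn ->]].
    have /mapP[p tp ->] := order_profile_mem At Ax.
    by exists p => //; have [_ -> ] := At.
  have [_ /(_ _ tn) /= cn _] := At.
  have : 0 < order_count A n.
    by rewrite cn lt0n; apply: contraNneq t0 => <-; apply: (map_f snd tn).
  case/card_gt0P=> x; rewrite inE => /andP[Ax /eqP xn].
  by exists x; rewrite // xn cn.
by rewrite card_fseq undup_id ?undup_uniq.
Qed.

Lemma order_count1 G : order_count G 1%N = 1%N.
Proof.
rewrite -[RHS](cards1 (1 : gT)); apply: eq_card => x.
by rewrite !inE order_eq1 andbC; case: eqP => // ->; rewrite group1.
Qed.

End OrderProfile.

Lemma order_count_isog (aT rT : finGroupType)
    (G : {group aT}) (H : {group rT}) n :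
  G \isog H -> order_count G n = order_count H n.
Proof.
case/isogP=> f injf <-; rewrite /order_count -(card_in_imset (f := f)).
  apply: eq_card => y; apply/imsetP/idP => [[x]|].
    rewrite !inE => /andP[Gx xn] ->.
    by rewrite mem_morphim //= order_injm.
  rewrite inE => /andP[/morphimP[x _ Gx ->]]; rewrite order_injm // => xn.
  by exists x; rewrite // inE Gx.
by move=> x y; rewrite !inE => /andP[Gx _] /andP[Gy _]; apply: (injmP injf).
Qed.

(** The fibres of G -> G / H have #|H| elements. *)
Lemma order_count_quotient (gT : finGroupType) (G H : {group gT}) n : H <| G ->
  (order_count (G / H) n * #|H|)%N = #|[set x in G | #[coset H x] == n]|.
Proof.
move=> nsHG; have [sHG nHG] := andP nsHG; rewrite -[RHS]sum1_card.
pose S := [set X in G / H | #[X] == n].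
rewrite (partition_big (coset H) (mem S)) /=; last first.
  by move=> x; rewrite !inE => /andP[Gx ->]; rewrite mem_quotient.
rewrite -sum_nat_const; apply: eq_bigr => X; rewrite inE.
case/andP=> /morphimP[y Ny Gy ->] oX.
rewrite sum1_card -(card_rcoset H y); apply: eq_card => x.
rewrite [RHS]unfold_in inE.
apply/idP/andP=> [Hyx | [/andP[Gx _] /eqP xy]].
  have Gx : x \in G.
    by case/rcosetP: Hyx => h Hh ->; rewrite groupM // (subsetP sHG).
  have -> : coset H x = coset H y.
    by apply/rcoset_kercosetP => //; apply: (subsetP nHG).
  by rewrite Gx oX.
by apply/rcoset_kercosetP => //; apply: (subsetP nHG).
Qed.

(** * Direct products of coprime order *)

Section DirectProduct.

Variables aT bT : finGroupType.

Lemma order_pair (x : aT) (y : bT) : #[(x, y)] = lcmn #[x] #[y].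
Proof.
have dvdE k : (#[(x, y)] %| k) = (#[x] %| k) && (#[y] %| k).
  rewrite !order_dvdn; suff -> : (x, y) ^+ k = (x ^+ k, y ^+ k) by [].
  by elim: k => // k IHk; rewrite !expgS IHk.
apply/eqP; rewrite eqn_dvd dvdE dvdn_lcml dvdn_lcmr /=.
by rewrite dvdn_lcm -dvdE.
Qed.

(** When the two group orders are coprime, a and b are recovered from a b as
its gcds with those orders, so (x, y) has order a b only if x has order a and
y has order b. *)
Lemma order_count_pair a b :
    coprime #|aT| #|bT| -> a %| #|aT| -> b %| #|bT| ->
  order_count [set: aT * bT] (a * b)%N
    = (order_count [set: aT] a * order_count [set: bT] b)%N.
Proof.
move=> co_ab a_dvd b_dvd; rewrite /order_count -cardsX.
apply: eq_card => -[x y]; rewrite !inE /= order_pair.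
have ox : #[x] %| #|aT| by rewrite -cardsT order_dvdG ?inE.
have oy : #[y] %| #|bT| by rewrite -cardsT order_dvdG ?inE.
(* A divisor pair is determined by its product. *)
have gcdE c d : c %| #|aT| -> d %| #|bT| ->
    gcdn #|aT| (c * d) = c /\ gcdn #|bT| (c * d) = d.
  move=> cA dB; rewrite Gauss_gcdl ?(coprime_dvdr dB) //.
  rewrite Gauss_gcdr ?(coprime_dvdr cA) 1?coprime_sym //.
  by split; apply/gcdn_idPr.
have -> : lcmn #[x] #[y] = (#[x] * #[y])%N.
  have := muln_lcm_gcd #[x] #[y].
  by rewrite (eqP (coprime_dvdl ox (coprime_dvdr oy co_ab))) muln1.
apply/eqP/andP => [xy|[/eqP-> /eqP-> //]].
have [] := gcdE _ _ ox oy; rewrite xy.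
by have [-> ->] := gcdE _ _ a_dvd b_dvd => -> ->.
Qed.

End DirectProduct.

(** * Simplicity from the number of elements of each order *)

Section NormalSubgroup.

Variables (gT : finGroupType) (G N : {group gT}).
Hypothesis nsNG : N <| G.

(** The order of the image of x in G / N divides both #[x] and |G : N|. *)
Lemma coprime_index_mem x : x \in G -> coprime #[x] #|G : N| -> x \in N.
Proof.
have [sNG nNG] := andP nsNG.
move=> Gx co_x; have Nx := subsetP nNG x Gx.
apply: coset_idr => //; apply/eqP; rewrite -order_eq1 -dvdn1 -(eqnP co_x).
by rewrite dvdn_gcd morph_order //= -card_quotient // order_dvdG ?mem_quotient.
Qed.

End NormalSubgroup.

(** The number of fixed points of x acting on N by conjugation is congruent to
|N| modulo #[x], so it is not 1; a nontrivial fixed point commutes with x and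
has order coprime to #[x]. *)
Lemma normal_order_mul (gT : finGroupType) (G N : {group gT}) x :
    N <| G -> x \in G -> prime #[x] -> coprime #[x] #|N| ->
    #|N| != 1%N %[mod #[x]] ->
  exists2 y, y \in N^# & #[x * y] = (#[x] * #[y])%N.
Proof.
move=> /andP[_ nNG] Gx p_pr co_xN N_mod.
have p_x : #[x].-group <[x]> by rewrite /pgroup -orderE pnat_id.
have x_acts : [acts <[x]>, on N | 'J].
  by rewrite astabsJ cycle_subG (subsetP nNG).
have [C1|/trivgPn[y]] := eqVneq ('C_N[x]) 1.
  case/eqP: N_mod; rewrite (pgroup_fix_mod p_x x_acts).
  by rewrite afixJ cent_cycle C1 cards1.
rewrite inE => /andP[Ny /cent1P cxy] nty; exists y; first by rewrite !inE nty.
by apply: orderM; rewrite // (coprime_dvdr (order_dvdG Ny)).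
Qed.

Definition PSL27_orders : seq (nat * nat) :=
  [:: (1, 1); (2, 21); (3, 56); (4, 42); (7, 48)]%N.

(** The function c j below counts the elements whose order is coprime to j;
all of them lie in any normal subgroup of index j. *)
Lemma PSL27_orders_simple (gT : finGroupType) (G : {group gT}) :
  order_profile G PSL27_orders -> simple G.
Proof.
move=> profG; have [_ cG oG] := profG; rewrite /= in oG.
apply/simpleP; split=> [|N nsNG].
  by apply: contra_eq_neq oG => ->; rewrite cards1.
have [sNG _] := andP nsNG.
have LN : (#|N| * #|G : N|)%N = 168 by rewrite Lagrange.
pose c j := sumn [seq p.2 | p <- PSL27_orders & (fun n => coprime n j) p.1].
have leN : c #|G : N| <= #|N|.
  apply: (order_profile_leq profG) => x Gx.
  exact: coprime_index_mem nsNG _ Gx.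
have [x Gx ox] : exists2 x, x \in G & #[x] = 7.
  have /card_gt0P[x] : 0 < order_count G 7 by rewrite (cG (7, 48)%N).
  by rewrite inE => /andP[Gx /eqP]; exists x.
(* For |N| = 2 or 4, the subgroup N would yield an element of order 7 #[y]. *)
have N_small : #|N| \in pred2 2 4 -> False.
  move=> oN; have [|||y] := normal_order_mul nsNG Gx; rewrite ox //.
  - by case/pred2P: oN => ->.
  - by case/pred2P: oN => ->.
  case/setD1P=> nt_y Ny oxy.
  have: #[x * y] \in unzip1 PSL27_orders.
    by rewrite (order_profile_mem profG) // groupM // (subsetP sNG).
  rewrite oxy; move: nt_y; rewrite -order_gt1.
  by case: #[y] => [|[|k]] // _; rewrite !mulnS.
(* The lower bound leN excludes all other orders of proper nontrivial N. *)
have small_c : {in divisors 168,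
    forall k, c (168 %/ k) <= k -> k \in [:: 1; 2; 4; 168]%N}.
  have: all (fun k => (c (168 %/ k) <= k) ==> (k \in [:: 1; 2; 4; 168]%N))
      (divisors 168) by [].
  by move/allP=> all_c k /all_c/implyP.
have /small_c: #|N| \in divisors 168 by rewrite -dvdn_divisors // -LN dvdn_mulr.
rewrite -{1}LN mulKn // => /(_ leN); rewrite !inE.
case/or4P=> [N1 | N2 | N4 | N168].
- by left; apply/card1_trivg/eqP.
- by case: N_small; rewrite inE N2.
- by case: N_small; rewrite inE N4 orbT.
by right; apply/eqP; rewrite eqEcard sNG oG (eqP N168).
Qed.

(** * The group Q_8 x (C_7 : C_3) *)

(** All elements outside a cyclic subgroup of order 4 have order 4, and there is
a single involution. *)
Lemma Q8_order_profile :
  order_profile [set: 'Q_8] [:: (1, 1); (2, 1); (4, 6)]%N.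
Proof.
have oQ : #|[set: 'Q_8]| = 8 by apply: (@card_quaternion 3).
have [[x y] genQ _] :=
  @generators_quaternion _ [set: 'Q_8]%G 3 isT (isog_refl _).
have [_ _ ox _] := genQ.
have [[_ o4 _] _ [_ _ o2 _ _] _ _] :=
  quaternion_structure (n := 3) isT genQ (isog_refl _).
have c2 : order_count [set: 'Q_8] 2 = 1%N.
  rewrite -[RHS](cards1 (x ^+ 2)); apply: eq_card => u; rewrite !inE /=.
  apply/eqP/eqP => [/(o2 u (in_setT u)) //|->].
  by rewrite orderXdiv ox.
have := @sum_order_count_all _ [set: 'Q_8] [:: 1; 2; 4]%N isT.
rewrite !big_cons big_nil addn0 order_count1 c2 oQ => sumQ.
split=> // p; rewrite !inE => /or3P[] /eqP-> //=; first exact: order_count1.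
suff /sumQ : {in [set: 'Q_8], forall u, #[u] \in [:: 1; 2; 4]%N} by case.
move=> u _; rewrite -[_ \in _]/(_ \in divisors 4) -dvdn_divisors //.
have [xu | x'u] := boolP (u \in <[x]>); last first.
  by rewrite o4 // !inE x'u.
by rewrite -[X in _ %| X]ox order_dvdG.
Qed.

(** An element of order 21 would generate an abelian G; the Sylow 7-subgroup is
normal and contains all 6 elements of order 7, so the remaining 14 nontrivial
elements have order 3. *)
Lemma order21_profile (gT : finGroupType) (G : {group gT}) :
  #|G| = 21 -> ~~ abelian G -> order_profile G [:: (1, 1); (3, 14); (7, 6)]%N.
Proof.
move=> oG cGG.
have oGs : {in G, forall x, #[x] \in [:: 1; 3; 7]%N}.
  move=> x Gx; have: #[x] \in divisors 21.
    by rewrite -dvdn_divisors -?oG ?order_dvdG.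
  rewrite (_ : divisors 21 = [:: 1; 3; 7; 21]%N) // !inE.
  case/or4P=> /eqP ox; rewrite ox //; case/negP: cGG.
  apply: abelianS (cycle_abelian x); rewrite (_ : <[x]> = G) //.
  by apply/eqP; rewrite eqEcard cycle_subG Gx -orderE ox oG.
have /normal_sylowP[P sylP nsPG] : #|'Syl_7(G)| == 1%N.
  have /eqP := card_Syl_mod G (isT : prime 7); have := card_Syl_dvd 7 G.
  rewrite oG dvdn_divisors // (_ : divisors 21 = [:: 1; 3; 7; 21]%N) // !inE.
  by case/or4P=> /eqP->.
have oP : #|P| = 7 by rewrite (card_Hall sylP) oG p_part.
have c7 : order_count G 7 = 6.
  have [oP1] : 7 = #|P^#|.+1 by rewrite -oP (cardsD1 1 P) group1.
  rewrite [RHS]oP1; apply: eq_card => x.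
  rewrite !inE -order_eq1; apply/andP/andP => [[Gx /eqP ox]|[x1 Px]].
    split; first by rewrite ox.
    apply: (coprime_index_mem nsPG) => //.
    by rewrite ox -divgS ?normal_sub // oG oP.
  split; first exact: subsetP (normal_sub nsPG) _ Px.
  have := order_dvdG Px; rewrite oP dvdn_divisors //.
  rewrite (_ : divisors 7 = [:: 1; 7]%N) //.
  by rewrite !inE (negPf x1).
have := @sum_order_count_all _ G [:: 1; 3; 7]%N isT oGs.
rewrite !big_cons big_nil addn0 order_count1 c7 oG => /= sumG.
split=> // p; rewrite !inE => /or3P[] /eqP-> //=; first exact: order_count1.
by apply: (@addIn 6); move: sumG; rewrite add1n => -[].
Qed.

Lemma Q8xF21_order_profile :
  order_profile Q8xF21 [:: (1, 1); (3, 14); (7, 6); (2, 1); (6, 14); (14, 6);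
                           (4, 6); (12, 84); (28, 36)]%N.
Proof.
have [_ cQ oQ] := Q8_order_profile.
have [_ cF oF] := order21_profile card_F21 F21_nonabelian.
have cX p q : p \in [:: (1, 1); (2, 1); (4, 6)]%N ->
    q \in [:: (1, 1); (3, 14); (7, 6)]%N ->
  order_count Q8xF21 (p.1 * q.1)%N = (p.2 * q.2)%N.
  move=> tp tq; rewrite order_count_pair ?(cQ p) ?(cF q) //.
  - by rewrite -!cardsT oQ oF.
  - by rewrite -cardsT oQ; move: tp; rewrite !inE => /or3P[] /eqP->.
  - by rewrite -cardsT oF; move: tq; rewrite !inE => /or3P[] /eqP->.
split=> //; last first.
  by rewrite cardsT card_prod -!cardsT oQ oF.
rewrite (_ : [:: _, _, _ & _] = [seq ((p.1 * q.1)%N, (p.2 * q.2)%N) |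
    p <- [:: (1, 1); (2, 1); (4, 6)]%N,
    q <- [:: (1, 1); (3, 14); (7, 6)]%N]) //.
by move=> r /allpairsP[[p q] [tp tq ->]]; apply: cX.
Qed.

(** * Powers of 2 x 2 matrices of determinant 1 *)

Section Lucas.
Local Open Scope ring_scope.

(** The Lucas sequence U_n(t, 1); equivalently, the Chebyshev polynomial of the
second kind of index n - 1 at t / 2. *)
Fixpoint lucas (R : comNzRingType) (t : R) n : R :=
  if n is m.+1 then (if m is k.+1 then t * lucas t m - lucas t k else 1) else 0.

Lemma det_mx22 (R : comNzRingType) (A : 'M[R]_2) :
  \det A = A 0 0 * A 1 1 - A 0 1 * A 1 0.
Proof.
rewrite (expand_det_row _ 0) !big_ord_recl big_ord0 addr0 /cofactor.
rewrite !det_mx11 !mxE /= expr0 expr1 mul1r mulN1r mulrN.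
by congr (_ * A _ _ - A _ _ * A _ _); apply: val_inj.
Qed.

Lemma mx22P (R : comNzRingType) (A B : 'M[R]_2) :
    A 0 0 = B 0 0 -> A 0 1 = B 0 1 -> A 1 0 = B 1 0 -> A 1 1 = B 1 1 ->
  A = B.
Proof.
have ord2 (i : 'I_2) : i = 0 \/ i = 1.
  by case: i => [[|[|//]] lt_i]; [left | right]; apply: val_inj.
by move=> *; apply/matrixP=> i j; case: (ord2 i) => ->; case: (ord2 j) => ->.
Qed.

Lemma sum2E (R : comNzRingType) (f : 'I_2 -> R) : \sum_i f i = f 0 + f 1.
Proof. by rewrite big_ord_recl big_ord1; congr (_ + f _); apply: val_inj. Qed.

Lemma is_scalar_mx22 (R : comNzRingType) (A : 'M[R]_2) :
  is_scalar_mx A = [&& A 0 1 == 0, A 1 0 == 0 & A 0 0 == A 1 1].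
Proof.
apply/is_scalar_mxP/and3P => [[a ->]|[/eqP A01 /eqP A10 /eqP A11]].
  by rewrite !mxE !eqxx.
by exists (A 0 0); apply: mx22P; rewrite !mxE.
Qed.

(** Induction on n from Cayley-Hamilton, A ^+ 2 = \tr A *: A - 1. The ring
identities are checked entrywise modulo the determinant equation. *)
Lemma expmx22_lucas (R : comNzRingType) (A : 'M[R]_2) n : \det A = 1 ->
  A ^+ n.+1 = lucas (\tr A) n.+1 *: A - (lucas (\tr A) n)%:M.
Proof.
rewrite det_mx22 => detA.
have {detA} bcE : A 0 1 * A 1 0 = A 0 0 * A 1 1 - 1 by rewrite -detA subKr.
elim: n => [|n IHn]; first by rewrite expr1 scale1r raddf0 subr0.
rewrite exprSr IHn; set l1 := lucas _ n.+1; set l0 := lucas _ n.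
have -> : lucas (\tr A) n.+2 = (A 0 0 + A 1 1) * l1 - l0.
  by rewrite -[lucas _ n.+2]/(\tr A * l1 - l0) {1}/mxtrace sum2E.
apply: mx22P; rewrite !mxE sum2E !mxE /= ?mulr1n ?mulr0n; ring: bcE.
Qed.
End Lucas.

(** * Orders in PSL(2, F) *)

Section SL2.
Local Open Scope ring_scope.
Variable F : finFieldType.
Implicit Types u : {'GL_2[F]}.

Definition mx22 (R : comNzRingType) (a b c d : R) : 'M[R]_2 :=
  \matrix_(i, j) if i == 0 then if j == 0 then a else b
                 else if j == 0 then c else d.

Lemma mx22E (R : comNzRingType) (a b c d : R) (A := mx22 a b c d) :
  [/\ A 0 0 = a, A 0 1 = b, A 1 0 = c & A 1 1 = d].
Proof. by rewrite {}/A; split; rewrite mxE. Qed.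

Lemma SL2_lift (A : 'M[F]_2) : \det A = 1 -> {u | u \in SL 2 F & GLval u = A}.
Proof.
move=> detA; have uA : A \is a GRing.unit by rewrite unitmxE detA unitr1.
by exists (Sub A uA); rewrite ?inE SubK ?detA.
Qed.

Lemma card_SL2_set (P : F -> F -> F -> F -> bool) :
  #|[set u in SL 2 F |
       P (GLval u 0 0) (GLval u 0 1) (GLval u 1 0) (GLval u 1 1)]|
  = (\sum_a \sum_b \sum_c \sum_d ((a * d - b * c == 1)%R && P a b c d))%N.
Proof.
rewrite pair_bigA /= pair_bigA /= pair_bigA /=.
pose e u := (GLval u 0 0, GLval u 0 1, GLval u 1 0, GLval u 1 1).
have e_inj : injective e by move=> u v [*]; apply/val_inj/mx22P.
rewrite -(card_imset _ e_inj) -sum1_card big_mkcond /=.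
apply: eq_bigr => -[[[a b] c] d] _ /=.
rewrite -[LHS]/(nat_of_bool (_ \in _)); congr (nat_of_bool _).
apply/imsetP/andP => [[u]|[/eqP det1 Pabcd]].
  by rewrite !inE det_mx22 => /andP[/eqP det1 Pu] [-> -> -> ->]; rewrite det1.
have [e00 e01 e10 e11] := mx22E a b c d.
have [|u Su uE] := @SL2_lift (mx22 a b c d).
  by rewrite det_mx22 e00 e01 e10 e11.
exists u; rewrite /e ?inE uE e00 e01 e10 e11 //.
by move: Su; rewrite inE uE => ->.
Qed.

(** A central matrix commutes with the two elementary transvections, which
forces it to be scalar. *)
Lemma mem_Z_SL2 u : u \in SL 2 F -> (u \in 'Z(SL 2 F)) = is_scalar_mx (GLval u).
Proof.
move=> Su; rewrite inE Su /=.
apply/centP/is_scalar_mxP => [cu | [a uE] v _]; last first.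
  apply: val_inj; change (GLval u *m GLval v = GLval v *m GLval u).
  by rewrite uE scalar_mxC.
have comm A : \det A = 1 -> GLval u * A = A * GLval u.
  by case/SL2_lift=> v Sv <-; rewrite -!GL_ME cu.
apply/is_scalar_mxP; rewrite is_scalar_mx22.
have [e00 e01 e10 e11] := mx22E 1 1 0 (1 : F).
have [f00 f01 f10 f11] := mx22E 1 0 1 (1 : F).
have /comm/matrixP U : \det (mx22 1 1 0 (1 : F)) = 1.
  by rewrite det_mx22 e00 e01 e10 e11 mulr0 subr0 mulr1.
have /comm/matrixP L : \det (mx22 1 0 1 (1 : F)) = 1.
  by rewrite det_mx22 f00 f01 f10 f11 mul0r subr0 mulr1.
have := U 0 1; have := U 0 0; have := L 0 0.
rewrite !mxE !sum2E e00 e01 e10 e11 f00 f01 f10.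
rewrite !(mulr0, mulr1, mul0r, mul1r, addr0, add0r).
move=> b0 c0 ad; apply/and3P; split; apply/eqP.
- by apply: (addrI (GLval u 0 0)); rewrite b0 addr0.
- by apply: (addrI (GLval u 0 0)); rewrite -c0 addr0.
by apply: (addIr (GLval u 0 1)); rewrite ad addrC.
Qed.

Lemma GLval_expg u n : GLval (u ^+ n)%g = GLval u ^+ n.
Proof. by elim: n => // n IHn; rewrite expgS exprS -IHn. Qed.

(** The power u ^+ n is central iff it is scalar; being a combination of u and
the identity with u not scalar, it is scalar iff the coefficient of u, namely
lucas (\tr u) n, is zero. *)
Lemma coset_SL2_expg u n : u \in SL 2 F -> ~~ is_scalar_mx (GLval u) ->
  ((coset 'Z(SL 2 F) u ^+ n)%g == 1%g) = (lucas (\tr (GLval u)) n == 0).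
Proof.
move=> Su u_ns.
have Nu : u \in 'N('Z(SL 2 F)) := subsetP (normal_norm (center_normal _)) u Su.
rewrite -morphX //=.
have -> : (coset 'Z(SL 2 F) (u ^+ n)%g == 1%g) = (u ^+ n \in 'Z(SL 2 F))%g.
  by apply/eqP/idP => [/coset_idr-> | /coset_id //]; rewrite ?groupX.
rewrite mem_Z_SL2 ?groupX // GLval_expg; case: n => [|n].
  by rewrite expr0 eqxx scalar_mx_is_scalar.
have det_u : \det (GLval u) = 1 by apply/eqP; move: Su; rewrite inE.
rewrite expmx22_lucas //; set l := lucas _ n.+1; set k := lucas _ n.
apply/idP/eqP => [|->]; last first.
  by rewrite scale0r sub0r -scaleN1r scale_scalar_mx scalar_mx_is_scalar.
apply: contraTeq => l_nz; apply: contra u_ns; rewrite !is_scalar_mx22 !mxE /=.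
rewrite !mulr0n !mulr1n !subr0 !mulf_eq0 (negPf l_nz) /=.
by rewrite (inj_eq (addIr _)) (inj_eq (mulfI l_nz)).
Qed.

(** For m > 0, m is the rank of apparition of zero in the Lucas sequence. *)
Definition lucas_order (t : F) m :=
  [&& lucas t m == 0 & all (fun k => lucas t k != 0) (iota 1 m.-1)].

Lemma order_coset_SL2 u m :
    u \in SL 2 F -> ~~ is_scalar_mx (GLval u) -> (0 < m)%N ->
  (#[coset 'Z(SL 2 F) u] == m) = lucas_order (\tr (GLval u)) m.
Proof.
move=> Su u_ns m_gt0; rewrite /lucas_order; apply/eqP/andP => [<- | []].
  split; first by rewrite -coset_SL2_expg ?expg_order.
  apply/allP=> k; rewrite mem_iota add1n prednK ?order_gt0 // => /andP[k0 k_lt].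
  rewrite -coset_SL2_expg // -order_dvdn.
  by apply: contraL k_lt => /(dvdn_leq k0); rewrite leqNgt.
rewrite -coset_SL2_expg // -order_dvdn => o_dvd /allP all_nz.
apply/eqP; rewrite eqn_leq dvdn_leq //= leqNgt; apply/negP=> o_lt.
have /all_nz : #[coset 'Z(SL 2 F) u] \in iota 1 m.-1.
  by rewrite mem_iota order_gt0 add1n prednK.
by rewrite -coset_SL2_expg // expg_order eqxx.
Qed.
End SL2.

(** * The counts in PSL(2, 7) *)

Section PSL27.
Local Open Scope ring_scope.

Lemma sum_F7 (f : 'F_7 -> nat) :
  (\sum_a f a = \sum_(0 <= i < 7) f (inZp i))%N.
Proof. by rewrite big_mkord; apply: eq_bigr => i _; rewrite valZpK. Qed.

(** The summation ranges over intervals of natural numbers and not over the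
finite type 'F_7, whose enumeration does not reduce; in this form the sum is
evaluated by vm_compute. *)
Definition SL27_count (P : 'F_7 -> 'F_7 -> 'F_7 -> 'F_7 -> bool) : nat :=
  (\sum_(0 <= i < 7) \sum_(0 <= j < 7) \sum_(0 <= k < 7) \sum_(0 <= l < 7)
    let: (a, b, c, d) := (inZp i, inZp j, inZp k, inZp l) in
    ((a * d - b * c == 1)%R && P a b c d))%N.

Lemma card_SL27_set (P : 'F_7 -> 'F_7 -> 'F_7 -> 'F_7 -> bool) :
  #|[set u in SL 2 'F_7 |
       P (GLval u 0 0) (GLval u 0 1) (GLval u 1 0) (GLval u 1 1)]|
  = SL27_count P.
Proof.
rewrite card_SL2_set.
by do 4![rewrite sum_F7; apply: eq_bigr => ? _].
Qed.

Definition scalar22 (a b c d : 'F_7) := [&& b == 0, c == 0 & a == d].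

Lemma card_SL27 : #|SL 2 'F_7| = 336%N.
Proof.
transitivity (SL27_count (fun _ _ _ _ => true)).
  by rewrite -card_SL27_set; apply: eq_card => u; rewrite [RHS]inE andbT.
by rewrite /SL27_count unlock; vm_compute.
Qed.

Lemma card_Z_SL27 : #|'Z(SL 2 'F_7)| = 2%N.
Proof.
transitivity (SL27_count scalar22); last first.
  by rewrite /SL27_count unlock; vm_compute.
rewrite -card_SL27_set; apply: eq_card => u; rewrite [RHS]inE.
have [Su | S'u] := boolP (u \in SL 2 'F_7).
  by rewrite mem_Z_SL2 // is_scalar_mx22.
by apply: contraNF S'u => /(subsetP (center_sub _)).
Qed.

(** For m > 0, whether the matrix with these entries has image of order m in
PSL(2, 7). *)
Definition order_PSL27_eq m (a b c d : 'F_7) :=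
  if scalar22 a b c d then 1%N == m else lucas_order (a + d) m.

(** The factor 2 is the order of the center of SL(2, 7). *)
Lemma order_count_PSL27 m : (0 < m)%N ->
  (order_count (PSL 2 'F_7) m * 2)%N = SL27_count (order_PSL27_eq m).
Proof.
move=> m_gt0; rewrite -[X in (_ * X)%N]card_Z_SL27.
rewrite order_count_quotient ?center_normal //.
rewrite -card_SL27_set; apply: eq_card => u; rewrite [LHS]inE [RHS]inE.
have [Su | //] := boolP (u \in SL 2 'F_7); rewrite /= /order_PSL27_eq.
rewrite -[scalar22 _ _ _ _]is_scalar_mx22.
have [u_sc | u_ns] := boolP (is_scalar_mx _).
  by rewrite coset_id ?mem_Z_SL2 // order1.
by rewrite order_coset_SL2 // /mxtrace sum2E.
Qed.

Lemma PSL27_order_profile : order_profile (PSL 2 'F_7) PSL27_orders.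
Proof.
have cS m k : (0 < m)%N -> SL27_count (order_PSL27_eq m) = (k * 2)%N ->
    order_count (PSL 2 'F_7) m = k.
  by move=> m_gt0 /eqP; rewrite -order_count_PSL27 // eqn_pmul2r // => /eqP.
split=> //.
  move=> p; rewrite !inE => /or4P[/eqP-> | /eqP-> | /eqP-> | /orP[]/eqP->];
    by apply: cS => //=; rewrite /SL27_count unlock; vm_compute.
rewrite card_quotient ?normal_norm ?center_normal //.
by rewrite -divgS ?center_sub // card_SL27 card_Z_SL27.
Qed.

End PSL27.

(** * The counterexample *)

Theorem mainTheorem3 :
  (let S := PSL 2 'F_7 in
   let G := Q8xF21 in
   [/\ [/\ simple S, ~~ abelian S & alpha_group 5 S],
       alpha_group 5 G,
       #|S| = 168 /\ #|G| = 168
     & ~~ (S \isog G)])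
  /\ ~ (forall n : nat, 0 < n ->
        forall (sT gT : finGroupType) (S : {group sT}) (G : {group gT}),
          simple S -> ~~ abelian S -> alpha_group n S -> alpha_group n G ->
          #|S| = #|G| -> S \isog G).
Proof.
have profS := PSL27_order_profile; have profG := Q8xF21_order_profile.
have simpleS := PSL27_orders_simple profS.
have [_ cS oS] := profS; have [_ cG oG] := profG.
have abelS : ~~ abelian (PSL 2 'F_7).
  apply/negP=> /abelian_sol/simple_sol_prime/(_ simpleS).
  by rewrite oS.
have alphaS : alpha_group 5 (PSL 2 'F_7) := alpha_group_profile profS isT.
have alphaG : alpha_group 5 Q8xF21 := alpha_group_profile profG isT.
have not_iso : ~~ (PSL 2 'F_7 \isog Q8xF21).
  (* There are 56 elements of order 3 on one side and 14 on the other. *)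
  by apply/negP=> /(order_count_isog 3); rewrite (cS (3, 56)%N) ?(cG (3, 14)%N).
split=> // all_iso; case/negP: not_iso; apply: (all_iso 5) => //.
by rewrite oS oG.
Qed.
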